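(* Consider the linear time-varying system, cost functions, DAC class $\mathcal{M}$ and Algorithm OLC-FK described in the context, under the standing assumptions stated there. Let $T\ge 3$, choose the memory length $h=\left\lceil \frac{\log T}{\log\left(1/(1-\gamma)\right)}\right\rceil$ and the step size $$\eta=\frac{D}{\sqrt{G_f\,(G_f+L_f h^2)\,T}} .$$ Then the regret of OLC-FK with respect to the comparator class of fixed DAC policies with gains in $\mathcal{M}$ satisfies $$R_T\le \mathcal{O}\!\left(D\sqrt{G_f\,(G_f+L_f h^2)}\;T^{1/2}\right),$$ where the $\mathcal{O}(\cdot)$ hides factors that do not depend on $T$ (other than through $h$, $G_f$, $L_f$ as displayed).
   Context: System: $x_{t+1}=A_tx_t+B_tu_t+w_t$, $y_t=C_tx_t+e_t$, $x_1=0$, with $x_t\in\mathbb{R}^n$, $u_t\in\mathbb{R}^m$, $y_t\in\mathbb{R}^p$, $w_t\in\mathbb{R}^n$, $e_t\in\mathbb{R}^p$; set $w_\tau=0,u_\tau=0$ for $\tau\le 0$. Norms are Euclidean for vectors and Frobenius for matrices unless $\|\cdot\|_2$ (spectral norm) is written. Standing assumptions: there are constants $\kappa_a,\kappa_b,\kappa_w,\kappa_e>0$ and $\gamma\in(0,1)$ with, for all $t$ and all $k\ge 0$, $\|C_{t+k+1}A_{t+k}\cdots A_{t+1}B_t\|_2\le\kappa_a\kappa_b(1-\gamma)^k$, $\|C_{t+k+1}A_{t+k}\cdots A_{t+1}\|_2\le\kappa_a(1-\gamma)^k$ (for $k=0$ the product of $A$'s is empty), $\|B_t\|_2\le\kappa_b$,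 $\|w_t\|\le\kappa_w$, $\|e_t\|\le\kappa_e$. Costs $c_t:\mathbb{R}^p\times\mathbb{R}^m\to\mathbb{R}$ are convex and differentiable; with $z=(y,u)$, $z'=(y',u')$ and $R=\max\{\|z\|,\|z'\|,1\}$, $|c_t(y,u)-c_t(y',u')|\le LR\|z-z'\|$; and for every $d>0$, if $\|y\|,\|u\|\le d$ then $\|\nabla_y c_t(y,u)\|\le Gd$, $\|\nabla_u c_t(y,u)\|\le Gd$. The sequences $A_t,B_t,C_t,w_t,e_t,c_t$ are arbitrary (time varying) subject to these assumptions. Markov parameters: $G_t^{[1]}=C_tB_{t-1}$, $G_t^{[k]}=C_tA_{t-1}\cdots A_{t-k+1}B_{t-k}$ for $k\ge2$ (these are known to the algorithm in this theorem). DAC class: $\mathcal{M}=\{M=(M^{[1]},\dots,M^{[h]}):M^{[k]}\in\mathbb{R}^{m\times n},\ \|M^{[k]}\|\le\kappa_M\}$, $\|M\|$ the Frobenius norm of the concatenation, $D=\sup_{M_1,M_2\in\mathcal{M}}\|M_1-M_2\|$. For $M\in\mathcal{M}$, the fixed DAC policy plays $u_t=\sum_{k=1}^hM^{[k]}w_{t-k}$; denote its outputs/inputs by $y_t^M,u_t^M$. Regret of an algorithm producing $(y_t,u_t)$: $R_T=\sum_{t=1}^Tc_t(y_t,u_t)-\min_{M\in\mathcal{M}}\sum_{t=1}^Tc_t(y^M_t,u^M_t)$. Algorithm OLC-FK: pick $M_1\in\mathcal{M}$. At each $t=1,\dots,T$: apply $u_t=\sum_{k=1}^hM_t^{[k]}w_{t-k}$;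 then observe $y_t$, $c_t$, $w_t$; let $s_t=y_t-\sum_{k=1}^{t-1}G_t^{[k]}u_{t-k}$, and for $M\in\mathcal{M}$ let $u_\tau(M)=\sum_{i=1}^hM^{[i]}w_{\tau-i}$ and $F_t(M)=c_t\big(s_t+\sum_{k=1}^hG_t^{[k]}u_{t-k}(M),\,u_t(M)\big)$; update $M_{t+1}=\mathrm{Proj}_{\mathcal{M}}\big(M_t-\eta\nabla F_t(M_t)\big)$ (Euclidean projection). Constants: $\widetilde D=\max\{\kappa_M\kappa_wh+\frac{\kappa_a\kappa_w}{\gamma}+\kappa_e+\frac{\kappa_a\kappa_b\kappa_M\kappa_wh}{\gamma},1\}$, $L_f=L\widetilde D(\kappa_a\kappa_b\kappa_w\sqrt h+\kappa_w\sqrt h)$, $G_f=G\widetilde D\,h\,n\,m\left(\frac{\kappa_a\kappa_b\kappa_w}{\gamma}+\kappa_w\right)$. *)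

(* Defs.v *)
From HB Require Import structures.
From mathcomp Require Import all_boot all_order all_algebra.
From mathcomp Require Import all_classical all_reals all_analysis.
Set Implicit Arguments. Unset Strict Implicit. Unset Printing Implicit Defensive.
Import Order.TTheory GRing.Theory Num.Theory.
Local Open Scope ring_scope.
Local Open Scope classical_set_scope.

Section OLC.
Variable R : realType.

Definition frob {k l : nat} (X : 'M[R]_(k, l)) : R :=
  Num.sqrt (\sum_(i < k) \sum_(j < l) X i j ^+ 2).
Definition fdot {k l : nat} (X Y : 'M[R]_(k, l)) : R :=
  \sum_(i < k) \sum_(j < l) X i j * Y i j.
Definition specnorm {k l : nat} (X : 'M[R]_(k, l)) : R :=
  sup [set frob (X *m v) | v in [set v : 'cV[R]_l | frob v <= 1]].

Definition znorm {p m : nat} (y : 'cV[R]_p) (u : 'cV[R]_m) : R :=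
  Num.sqrt (frob y ^+ 2 + frob u ^+ 2).

(* DAC gain M = (M^[1],...,M^[h]); M^[k] is stored at index k-1 *)
Definition dac (h m n : nat) := 'I_h -> 'M[R]_(m, n).
Definition dsub {h m n : nat} (M N : dac h m n) : dac h m n := fun k => M k - N k.
Definition olc_dadd {h m n : nat} (M N : dac h m n) : dac h m n := fun k => M k + N k.
Definition olc_dscale {h m n : nat} (a : R) (M : dac h m n) : dac h m n := fun k => a *: M k.
Definition dnorm {h m n : nat} (M : dac h m n) : R :=
  Num.sqrt (\sum_(k < h) frob (M k) ^+ 2).
Definition ddot {h m n : nat} (M N : dac h m n) : R :=
  \sum_(k < h) fdot (M k) (N k).

Definition inM {h m n : nat} (kM : R) (M : dac h m n) : Prop :=
  forall k, frob (M k) <= kM.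
Definition Ddiam (h m n : nat) (kM : R) : R :=
  sup [set d | exists M1 M2 : dac h m n, inM kM M1 /\ inM kM M2 /\ d = dnorm (dsub M1 M2)].

(* disturbance with w_tau = 0 for tau <= 0 (time index 0 plays the role of tau <= 0) *)
Definition wz {n : nat} (w : nat -> 'cV[R]_n) (t : nat) : 'cV[R]_n :=
  if t is 0 then 0 else w t.

Fixpoint Aprod {n : nat} (A : nat -> 'M[R]_n) (s j : nat) : 'M[R]_n :=
  match j with 0 => 1%:M | j'.+1 => A (s + j) *m Aprod A s j' end.

Fixpoint xstate {n m : nat} (A : nat -> 'M[R]_n) (B : nat -> 'M[R]_(n, m))
  (w : nat -> 'cV[R]_n) (u : nat -> 'cV[R]_m) (t : nat) : 'cV[R]_n :=
  match t with
  | 0 => 0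
  | t'.+1 => if t' is 0 then 0
             else A t' *m xstate A B w u t' + B t' *m u t' + w t'
  end.

Definition yout {n m p : nat} (A : nat -> 'M[R]_n) (B : nat -> 'M[R]_(n, m))
  (C : nat -> 'M[R]_(p, n)) (w : nat -> 'cV[R]_n) (e : nat -> 'cV[R]_p)
  (u : nat -> 'cV[R]_m) (t : nat) : 'cV[R]_p :=
  C t *m xstate A B w u t + e t.

Definition dacu {h m n : nat} (w : nat -> 'cV[R]_n) (M : dac h m n) (tau : nat) : 'cV[R]_m :=
  \sum_(i < h) M i *m wz w (tau - i.+1)%N.

Definition olc_markov {n m p : nat} (A : nat -> 'M[R]_n) (B : nat -> 'M[R]_(n, m))
  (C : nat -> 'M[R]_(p, n)) (t k : nat) : 'M[R]_(p, m) :=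
  C t *m Aprod A (t - k)%N (k.-1)%N *m B (t - k)%N.

Definition ualg {h m n : nat} (w : nat -> 'cV[R]_n) (Ms : nat -> dac h m n) (t : nat) :=
  dacu w (Ms t) t.

Definition olc_sig {h n m p : nat} A B C w e (Ms : nat -> dac h m n) (t : nat) : 'cV[R]_p :=
  @yout n m p A B C w e (ualg w Ms) t
  - \sum_(1 <= k < t) olc_markov A B C t k *m ualg w Ms (t - k)%N.

Definition Ffun {h n m p : nat} A B C w e (c : nat -> 'cV[R]_p -> 'cV[R]_m -> R)
  (Ms : nat -> dac h m n) (t : nat) (M : dac h m n) : R :=
  c t (@olc_sig h n m p A B C w e Ms t + \sum_(1 <= k < h.+1) olc_markov A B C t k *m dacu w M (t - k)%N)
      (dacu w M t).

Definition is_grad {p m : nat} (f : 'cV[R]_p -> 'cV[R]_m -> R)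
  (gy : 'cV[R]_p -> 'cV[R]_m -> 'cV[R]_p) (gu : 'cV[R]_p -> 'cV[R]_m -> 'cV[R]_m) : Prop :=
  forall y u (eps : R), 0 < eps -> exists2 del : R, 0 < del &
    forall dy du, znorm dy du < del ->
      `|f (y + dy) (u + du) - f y u - (fdot (gy y u) dy + fdot (gu y u) du)|
        <= eps * znorm dy du.

Definition is_gradD {h m n : nat} (F : dac h m n -> R) (M0 g : dac h m n) : Prop :=
  forall eps : R, 0 < eps -> exists2 del : R, 0 < del &
    forall dM : dac h m n, dnorm dM < del ->
      `|F (olc_dadd M0 dM) - F M0 - ddot g dM| <= eps * dnorm dM.

Definition convex2 {p m : nat} (f : 'cV[R]_p -> 'cV[R]_m -> R) : Prop :=
  forall y u y' u' (lam : R), 0 <= lam <= 1 ->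
    f (lam *: y + (1 - lam) *: y') (lam *: u + (1 - lam) *: u')
      <= lam * f y u + (1 - lam) * f y' u'.

Definition is_projM {h m n : nat} (kM : R) (X P : dac h m n) : Prop :=
  inM kM P /\ forall M, inM kM M -> dnorm (dsub X P) <= dnorm (dsub X M).

Definition regret {h n m p : nat} A B C w e (c : nat -> 'cV[R]_p -> 'cV[R]_m -> R)
  (kM : R) (Ms : nat -> dac h m n) (T : nat) : R :=
  \sum_(1 <= t < T.+1) c t (@yout n m p A B C w e (ualg w Ms) t) (ualg w Ms t)
  - inf [set \sum_(1 <= t < T.+1)
             c t (@yout n m p A B C w e (dacu w M) t) (dacu w M t)
        | M in [set M : dac h m n | inM kM M]].

Definition hmem (T : nat) (gam : R) : nat :=
  `|Num.ceil (ln (T%:R) / ln ((1 - gam)^-1))|%N.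

Definition Dtil (h : nat) (ka kb kw ke gam kM : R) : R :=
  Num.max (kM * kw * h%:R + ka * kw / gam + ke + ka * kb * kM * kw * h%:R / gam) 1.
Definition Lf (h : nat) (ka kb kw ke gam kM L : R) : R :=
  L * Dtil h ka kb kw ke gam kM * (ka * kb * kw * Num.sqrt h%:R + kw * Num.sqrt h%:R).
Definition Gf (h n m : nat) (ka kb kw ke gam kM G : R) : R :=
  G * Dtil h ka kb kw ke gam kM * h%:R * n%:R * m%:R * (ka * kb * kw / gam + kw).

End OLC.

(* Main.v *)
(** Subtracting the effect of the inputs leaves a natural response independent of
the policy, so with memory [h] the surrogate [Ffun] is convex in the gains and, by
the Lipschitz assumption, its gradients have norm O(L Dtil sqrt h).  The regret
splits into three parts: projected gradient descent on the surrogates costs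
D^2/(2 eta) + eta/2 times the sum of squared gradient norms; replacing the
past gains by the current ones costs at most h steps of drift, each of length at
most eta times the gradient bound, damped by a geometric series in [1 - gam]; and
truncating the response at lag [h] costs a term proportional to
[(1 - gam)^h <= 1/T], both for the algorithm and for the comparator.
Since the constant may depend on L and G, all three are compared with Gf and Lf
through the ratio L/G.  When L <= 0 or G <= 0 the costs are constant, and
when m or n is 0 all policies coincide; then the regret is nonpositive. *)

Require Import Defs.
From HB Require Import structures.
From mathcomp Require Import all_boot all_order all_algebra.
From mathcomp Require Import all_classical all_reals all_analysis.
From mathcomp Require Import ring lra.
Import Order.TTheory GRing.Theory Num.Theory.
Local Open Scope ring_scope.

(** * Euclidean, Frobenius and spectral norms *)

Section EuclideanNorms.
Set Implicit Arguments. Unset Strict Implicit.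
Context {R : realType}.

(** With [x] and [y] the two norms and [S] the sum of products, the sum of the squares of
    [y * a i - x * b i] is nonnegative and equals [2 * (x * y) * (x * y - S)]. Cancelling [x * y]
    requires both norms nonzero, hence the two separate cases. *)
Lemma cauchy_schwarz (I : finType) (a b : I -> R) :
  \sum_i a i * b i
    <= Num.sqrt (\sum_i a i ^+ 2) * Num.sqrt (\sum_i b i ^+ 2).
Proof.
have sq0 (c : I -> R) : 0 <= \sum_i c i ^+ 2.
  by apply: sumr_ge0 => i _; exact: sqr_ge0.
set x := Num.sqrt _; set y := Num.sqrt _.
have Ex : x ^+ 2 = \sum_i a i ^+ 2 by rewrite sqr_sqrtr.
have Ey : y ^+ 2 = \sum_i b i ^+ 2 by rewrite sqr_sqrtr.
have x0 : 0 <= x by exact: sqrtr_ge0.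
have y0 : 0 <= y by exact: sqrtr_ge0.
have zero (c : I -> R) : \sum_i c i ^+ 2 = 0 -> forall i, c i = 0.
  move=> c0 i; apply/eqP; rewrite -sqrf_eq0; apply/eqP.
  by apply: (psumr_eq0P _ c0) => // j _; exact: sqr_ge0.
have [x1|x1] := eqVneq x 0.
  rewrite big1 ?mulr_ge0 // => i _.
  by rewrite (zero a) ?mul0r // -Ex x1 expr0n.
have [y1|y1] := eqVneq y 0.
  rewrite big1 ?mulr_ge0 // => i _.
  by rewrite (zero b) ?mulr0 // -Ey y1 expr0n.
have xy : 0 < x * y by rewrite mulr_gt0 // lt_neqAle eq_sym ?x1 ?y1.
have : 0 <= \sum_i (y * a i - x * b i) ^+ 2 by [].
rewrite (eq_bigr (fun i => y ^+ 2 * a i ^+ 2 + x ^+ 2 * b i ^+ 2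
   - (2 * (x * y)) * (a i * b i))); last by move=> i _; ring.
rewrite sumrB big_split /= -!mulr_sumr -Ex -Ey.
set S := \sum_i _.
rewrite (_ : _ - _ = 2 * (x * y) * (x * y - S)); last by ring.
by rewrite pmulr_rge0 ?subr_ge0 // mulr_gt0.
Qed.

Lemma l2_triangle (I : finType) (a b : I -> R) :
  Num.sqrt (\sum_i (a i + b i) ^+ 2)
    <= Num.sqrt (\sum_i a i ^+ 2) + Num.sqrt (\sum_i b i ^+ 2).
Proof.
have sq0 (c : I -> R) : 0 <= \sum_i c i ^+ 2.
  by apply: sumr_ge0 => i _; exact: sqr_ge0.
rewrite -[leRHS]ger0_norm ?addr_ge0 ?sqrtr_ge0 //.
rewrite -sqrtr_sqr ler_wsqrtr // sqrrD !sqr_sqrtr //.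
rewrite (eq_bigr (fun i => a i ^+ 2 + 2 * (a i * b i) + b i ^+ 2)); last first.
  by move=> i _; ring.
rewrite !big_split /= lerD2r lerD2l -mulr_sumr -[leRHS]mulr_natl ler_pM2l //.
exact: cauchy_schwarz.
Qed.

(** A single sum over index pairs brings matrices under the two inequalities above, which are stated
    for one finite index type. *)
Lemma frobE k l (X : 'M[R]_(k, l)) :
  frob X = Num.sqrt (\sum_(q : 'I_k * 'I_l) X q.1 q.2 ^+ 2).
Proof. by rewrite /frob pair_bigA. Qed.

Lemma fdotE k l (X Y : 'M[R]_(k, l)) :
  fdot X Y = \sum_(q : 'I_k * 'I_l) X q.1 q.2 * Y q.1 q.2.
Proof. by rewrite /fdot pair_bigA. Qed.

Lemma frob_ge0 k l (X : 'M[R]_(k, l)) : 0 <= frob X.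
Proof. exact: sqrtr_ge0. Qed.

Lemma frob_sqr k l (X : 'M[R]_(k, l)) : frob X ^+ 2 = fdot X X.
Proof.
rewrite /frob sqr_sqrtr; last first.
  by apply: sumr_ge0 => i _; apply: sumr_ge0 => j _; exact: sqr_ge0.
by [].
Qed.

Lemma frobD k l (X Y : 'M[R]_(k, l)) : frob (X + Y) <= frob X + frob Y.
Proof.
rewrite !frobE; under eq_bigr do rewrite mxE; exact: l2_triangle.
Qed.

Lemma frobZ k l (a : R) (X : 'M[R]_(k, l)) : frob (a *: X) = `|a| * frob X.
Proof.
rewrite !frobE; under eq_bigr do rewrite mxE exprMn.
by rewrite -mulr_sumr sqrtrM ?sqr_ge0 // sqrtr_sqr.
Qed.

Lemma frobN k l (X : 'M[R]_(k, l)) : frob (- X) = frob X.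
Proof. by rewrite -scaleN1r frobZ normrN1 mul1r. Qed.

Lemma frob0 k l : frob (0 : 'M[R]_(k, l)) = 0.
Proof. by rewrite -(scale0r 0) frobZ normr0 mul0r. Qed.

Lemma frob_eq0 k l (X : 'M[R]_(k, l)) : frob X = 0 -> X = 0.
Proof.
move=> X0; have := frob_sqr X; rewrite X0 expr0n /= fdotE => /esym/psumr_eq0P H.
apply/matrixP => i j; rewrite mxE; apply/eqP.
rewrite -sqrf_eq0 expr2; apply/eqP; apply: (H _ (i, j)) => // q _.
exact: sqr_ge0.
Qed.

Lemma frob_sum k l (I : Type) (r : seq I) (P : pred I) (X : I -> 'M[R]_(k, l)) :
  frob (\sum_(i <- r | P i) X i) <= \sum_(i <- r | P i) frob (X i).
Proof.
apply: (big_ind2 (fun u v => frob u <= v)) => //.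
  by rewrite frob0.
move=> X1 x1 X2 x2 H1 H2; apply: le_trans (frobD _ _) _; exact: lerD.
Qed.

Lemma frob_mulmx k l (X : 'M[R]_(k, l)) (v : 'cV[R]_l) :
  frob (X *m v) <= frob X * frob v.
Proof.
have sq0 (J : finType) (c : J -> R) : 0 <= \sum_i c i ^+ 2.
  by apply: sumr_ge0 => i _; exact: sqr_ge0.
have Ev : frob v = Num.sqrt (\sum_j v j 0 ^+ 2).
  by rewrite /frob; congr Num.sqrt; apply: eq_bigr => i _; rewrite big_ord1.
rewrite Ev /frob -sqrtrM; last by apply: sumr_ge0 => i _; exact: sq0.
apply: ler_wsqrtr; rewrite mulr_suml; apply: ler_sum => i _.
rewrite big_ord1 mxE -ler_sqrt; last by rewrite mulr_ge0 ?sq0.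
rewrite sqrtr_sqr sqrtrM // ler_norml; apply/andP; split; last exact: cauchy_schwarz.
rewrite lerNl -sumrN.
under eq_bigr do rewrite -mulNr.
apply: le_trans (cauchy_schwarz _ _) _.
by under eq_bigr do rewrite sqrrN.
Qed.

(** A [sup] bounds its elements only when the set is bounded above; the Frobenius norm of [X]
    supplies such a bound. *)
Lemma specnorm_ubound k l (X : 'M[R]_(k, l)) (v : 'cV[R]_l) :
  frob v <= 1 -> frob (X *m v) <= specnorm X.
Proof.
move=> v1; apply: ub_le_sup; last by exists v.
exists (frob X) => _ [u /= u1 <-].
by apply: le_trans (frob_mulmx _ _) _; rewrite ler_piMr ?frob_ge0.
Qed.

Lemma frob_mulmx_specnorm k l (X : 'M[R]_(k, l)) (v : 'cV[R]_l) :
  frob (X *m v) <= specnorm X * frob v.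
Proof.
have [/frob_eq0 ->|v0] := eqVneq (frob v) 0; first by rewrite mulmx0 !frob0 mulr0.
have vp : 0 < frob v by rewrite lt_neqAle eq_sym v0 frob_ge0.
rewrite -ler_pdivrMr // mulrC -{1}[frob v]ger0_norm ?frob_ge0 // -normfV -frobZ.
rewrite scalemxAr; apply: specnorm_ubound.
by rewrite frobZ ger0_norm ?invr_ge0 ?frob_ge0 // mulVf.
Qed.

Lemma znorm_le p m (y : 'cV[R]_p) (u : 'cV[R]_m) : znorm y u <= frob y + frob u.
Proof.
have yu : 0 <= frob y + frob u by rewrite addr_ge0 ?frob_ge0.
rewrite /znorm -[leRHS]ger0_norm // -sqrtr_sqr ler_wsqrtr // sqrrD.
by rewrite lerD2r lerDl mulrn_wge0 // mulr_ge0 ?frob_ge0.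
Qed.

Lemma znorm_ge0 p m (y : 'cV[R]_p) (u : 'cV[R]_m) : 0 <= znorm y u.
Proof. exact: sqrtr_ge0. Qed.

Lemma fdotC k l (X Y : 'M[R]_(k, l)) : fdot X Y = fdot Y X.
Proof. by rewrite !fdotE; apply: eq_bigr => q _; rewrite mulrC. Qed.

Lemma fdotDl k l (X Y Z : 'M[R]_(k, l)) : fdot (X + Y) Z = fdot X Z + fdot Y Z.
Proof.
rewrite !fdotE -big_split /=; apply: eq_bigr => q _; by rewrite mxE mulrDl.
Qed.

Lemma fdotZl k l (a : R) (X Z : 'M[R]_(k, l)) : fdot (a *: X) Z = a * fdot X Z.
Proof.
rewrite !fdotE mulr_sumr; apply: eq_bigr => q _; by rewrite mxE mulrA.
Qed.

End EuclideanNorms.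

(** * Inner-product geometry of the gain space and projection onto the class *)

Section GainSpace.
Set Implicit Arguments. Unset Strict Implicit.
Context {R : realType} {h m n : nat}.
Implicit Types M N P X g : dac R h m n.

Lemma ddotC M N : ddot M N = ddot N M.
Proof. by apply: eq_bigr => k _; rewrite fdotC. Qed.

Lemma ddotDl M N P : ddot (olc_dadd M N) P = ddot M P + ddot N P.
Proof. by rewrite -big_split; apply: eq_bigr => k _; rewrite fdotDl. Qed.

Lemma ddotZl (a : R) M P : ddot (olc_dscale a M) P = a * ddot M P.
Proof. by rewrite mulr_sumr; apply: eq_bigr => k _; rewrite fdotZl. Qed.

Lemma ddotBl M N P : ddot (dsub M N) P = ddot M P - ddot N P.
Proof.
rewrite -sumrB; apply: eq_bigr => k _.
by rewrite fdotDl -scaleN1r fdotZl mulN1r.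
Qed.

Lemma ddotDr M N P : ddot P (olc_dadd M N) = ddot P M + ddot P N.
Proof. by rewrite ddotC ddotDl !(ddotC P). Qed.

Lemma ddotBr M N P : ddot P (dsub M N) = ddot P M - ddot P N.
Proof. by rewrite ddotC ddotBl !(ddotC P). Qed.

Lemma ddotZr (a : R) M P : ddot P (olc_dscale a M) = a * ddot P M.
Proof. by rewrite ddotC ddotZl ddotC. Qed.

Definition ddotE :=
  (ddotDl, ddotDr, ddotBl, ddotBr, ddotZl, ddotZr).

Lemma dnorm_ge0 M : 0 <= dnorm M.
Proof. exact: sqrtr_ge0. Qed.

Lemma dnorm_sqr M : dnorm M ^+ 2 = ddot M M.
Proof.
rewrite /dnorm sqr_sqrtr; last by apply: sumr_ge0 => k _; exact: sqr_ge0.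
by apply: eq_bigr => k _; rewrite frob_sqr.
Qed.

Lemma dnormD M N : dnorm (olc_dadd M N) <= dnorm M + dnorm N.
Proof.
apply: le_trans (l2_triangle (fun k => frob (M k)) (fun k => frob (N k))).
apply: ler_wsqrtr; apply: ler_sum => k _.
by rewrite ler_sqr ?nnegrE ?addr_ge0 ?frob_ge0 ?frobD.
Qed.

Lemma dnormZ (a : R) M : dnorm (olc_dscale a M) = `|a| * dnorm M.
Proof.
rewrite /dnorm; under eq_bigr do rewrite /olc_dscale frobZ exprMn.
by rewrite -mulr_sumr sqrtrM ?sqr_ge0 // sqrtr_sqr normr_id.
Qed.

Lemma dnormB_sym M N : dnorm (dsub M N) = dnorm (dsub N M).
Proof.
by congr Num.sqrt; apply: eq_bigr => k _; rewrite /dsub -opprB frobN.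
Qed.

Lemma dnormB_triangle M N P :
  dnorm (dsub M P) <= dnorm (dsub M N) + dnorm (dsub N P).
Proof.
apply: le_trans (dnormD _ _); rewrite le_eqVlt; apply/orP; left; apply/eqP.
by congr Num.sqrt; apply: eq_bigr => k _; rewrite /olc_dadd /dsub addrA subrK.
Qed.

(** Cauchy-Schwarz against the constant family 1. This produces the factor [Num.sqrt h%:R] in the
    gradient and drift bounds. *)
Lemma sum_frob_le M : \sum_(k < h) frob (M k) <= Num.sqrt h%:R * dnorm M.
Proof.
have := cauchy_schwarz (fun=> 1) (fun k => frob (M k)).
under eq_bigr do rewrite mul1r.
by under [X in Num.sqrt X * _]eq_bigr do rewrite expr1n; rewrite sumr_const card_ord.
Qed.

Lemma inM_dnorm (kM : R) M : inM kM M -> dnorm M <= kM * Num.sqrt h%:R.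
Proof.
(* Without any block, [inM] gives no information on the sign of [kM]; the norm is then an empty
   sum. *)
have [h0|h0] := posnP h.
  move=> _; rewrite /dnorm big1 ?sqrtr0 ?h0 ?sqrtr0 ?mulr0 // => -[i ih] _.
  by exfalso; move: ih; rewrite h0.
move=> HM; have kM0 : 0 <= kM by apply: le_trans (HM (Ordinal h0)); exact: frob_ge0.
rewrite -[kM]ger0_norm // -sqrtr_sqr -sqrtrM ?sqr_ge0 //.
rewrite ler_wsqrtr // mulr_natr -[X in _ *+ X]card_ord -sumr_const.
apply: ler_sum => k _; rewrite ler_sqr ?nnegrE ?frob_ge0 //; exact: HM.
Qed.

Lemma Ddiam_ubound (kM : R) M N : inM kM M -> inM kM N ->
  dnorm (dsub M N) <= Ddiam h m n kM.
Proof.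
move=> HM HN; apply: ub_le_sup; last by exists M, N.
exists (2 * (kM * Num.sqrt h%:R)) => _ [M1 [M2 [H1 [H2 ->]]]].
pose Z : dac R h m n := fun=> 0.
apply: le_trans (dnormB_triangle _ Z _) _.
rewrite [dnorm (dsub Z _)]dnormB_sym.
have E M0 : dnorm (dsub M0 Z) = dnorm M0.
  by congr Num.sqrt; apply: eq_bigr => k _; rewrite /dsub subr0.
by rewrite !E mulr_natl mulr2n lerD ?inM_dnorm.
Qed.

(** The gain whose blocks are all [kM] times one matrix unit lies at distance at least [kM] from
    zero, and both belong to the class. The bound makes the step size positive and lets the
    truncation terms, which carry [kM], be charged to [D]. *)
Lemma Ddiam_ge (kM : R) : 0 < kM -> (0 < h)%N -> (0 < m)%N -> (0 < n)%N ->
  kM <= Ddiam h m n kM.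
Proof.
move=> kM0 h0 m0 n0.
pose E : 'M[R]_(m, n) := delta_mx (Ordinal m0) (Ordinal n0).
have E1 : frob E = 1.
  rewrite -[RHS]sqrtr1 frobE (bigD1 (Ordinal m0, Ordinal n0)) //= mxE !eqxx.
  rewrite expr1n big1 ?addr0 // => -[i j] /= ij; rewrite mxE.
  have -> : (i == Ordinal m0) && (j == Ordinal n0) = false by exact: negbTE ij.
  by rewrite expr0n.
pose M : dac R h m n := fun=> kM *: E; pose Z : dac R h m n := fun=> 0.
have HZ : inM kM Z by move=> k; rewrite frob0 ltW.
have HM : inM kM M by move=> k; rewrite frobZ E1 mulr1 ger0_norm // ltW.
apply: le_trans (Ddiam_ubound HM HZ).
rewrite -[kM in leLHS]ger0_norm ?(ltW kM0) // -sqrtr_sqr /dnorm ler_wsqrtr //.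
rewrite (bigD1 (Ordinal h0)) //= /dsub subr0 frobZ E1 mulr1 real_normK ?num_real //.
by rewrite lerDl sumr_ge0 // => k _; exact: sqr_ge0.
Qed.

(** If [a] were positive, [s = 1] would give [a <= b], so [s = a / (2 * b)] would be admissible and
    would give [a <= a / 2]. *)
Lemma le0_of_vanishing (a b : R) :
  (forall s, 0 < s <= 1 -> a <= s * b) -> a <= 0.
Proof.
move=> H; rewrite leNgt; apply/negP => a0.
have b0 : 0 < b by apply: lt_le_trans a0 _; rewrite -[b]mul1r H // ltr01 lexx.
have ab : a / (2 * b) * b = a / 2 by field; rewrite gt_eqF.
have := H (a / (2 * b)); rewrite ab divr_gt0 ?mulr_gt0 //= ler_pdivrMr ?mulr_gt0 //.
have : a <= b by rewrite -[b]mul1r H // ltr01 lexx.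
lra.
Qed.

(** Comparing [P] with the points of the segment from [P] to [M], which stay in the class by
    convexity of the norm balls, and letting them tend to [P] gives a nonpositive inner product of
    [X - P] and [M - P]. Expanding the squared distance from [X] to [M] around [P] then
    concludes. *)
Lemma projM_nonexpansive (kM : R) X P M : is_projM kM X P -> inM kM M ->
  dnorm (dsub P M) ^+ 2 <= dnorm (dsub X M) ^+ 2.
Proof.
move=> [HP Hmin] HM.
have obtuse : 2 * ddot (dsub X P) (dsub M P) <= 0.
  apply: (le0_of_vanishing (b := dnorm (dsub M P) ^+ 2)) => s /andP[s0 s1].
  pose N := olc_dadd P (olc_dscale s (dsub M P)).
  have HN : inM kM N.
    move=> k; have -> : N k = (1 - s) *: P k + s *: M k.
      by rewrite /N /olc_dadd /olc_dscale /dsub scalerBr scalerBl scale1r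
        addrA addrAC.
    apply: le_trans (frobD _ _) _; rewrite !frobZ !ger0_norm ?subr_ge0 ?(ltW s0) //.
    rewrite (_ : kM = (1 - s) * kM + s * kM); last by ring.
    by apply: lerD; apply: ler_wpM2l; rewrite ?subr_ge0 ?(ltW s0).
  have := Hmin N HN; rewrite -ler_sqr ?nnegrE ?dnorm_ge0 //.
  rewrite !dnorm_sqr /N !ddotE [ddot M X]ddotC [ddot P X]ddotC [ddot P M]ddotC.
  by move=> H; rewrite -(ler_pM2l s0); lra.
rewrite !dnorm_sqr; move: obtuse.
rewrite !ddotE [ddot M X]ddotC [ddot M P]ddotC.
have : 0 <= dnorm (dsub X P) ^+ 2 by exact: sqr_ge0.
rewrite dnorm_sqr !ddotE [ddot P X]ddotC.
lra.
Qed.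

End GainSpace.

(** * First-order inequalities and projected gradient descent *)

Section FirstOrder.
Context {R : realType}.
Set Implicit Arguments. Unset Strict Implicit.

(** Near 0 the chord of slope [f1 - phi 0] lies above [phi], whose right derivative there is [a].
    The one-dimensional form serves both the surrogates and the costs, restricted to segments. *)
Lemma convex_slope_le (phi : R -> R) (a f1 : R) :
  (forall eps, 0 < eps -> exists2 del, 0 < del & forall s, 0 < s < del ->
     `|phi s - phi 0 - s * a| <= eps * s) ->
  (forall s, 0 <= s <= 1 -> phi s <= s * f1 + (1 - s) * phi 0) ->
  a <= f1 - phi 0.
Proof.
move=> Hd Hc; apply/ler_addgt0Pr => eps eps0.
have [del del0 H] := Hd _ eps0.
pose s := Num.min (del / 2) 1.
have s0 : 0 < s by rewrite lt_min divr_gt0 //= ltr01.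
have s1 : s <= 1 by rewrite ge_min lexx orbT.
have sd : s < del by rewrite gt_min; apply/orP; left; lra.
have := H s; rewrite s0 sd => /(_ isT); rewrite ler_norml => /andP[H1 _].
have := Hc s; rewrite (ltW s0) s1 => /(_ isT) H2.
rewrite -(ler_pM2l s0).
have -> : s * (f1 - phi 0 + eps) = s * f1 + (1 - s) * phi 0 - phi 0 + eps * s.
  by ring.
lra.
Qed.

(** The derivative is tested along [g] itself, with a step of length [r] below both radii. The
    Lipschitz bound is local because the costs are Lipschitz only on bounded sets. *)
Lemma is_gradD_norm_le h m n (F : dac R h m n -> R) (M g : dac R h m n) (K rho : R) :
  0 <= K -> 0 < rho -> is_gradD F M g ->
  (forall dM, dnorm dM < rho -> `|F (olc_dadd M dM) - F M| <= K * dnorm dM) ->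
  dnorm g <= K.
Proof.
move=> K0 rho0 HF Hlip; apply/ler_addgt0Pr => eps eps0.
have [del del0 H] := HF _ eps0.
have [->|g0] := eqVneq (dnorm g) 0; first by rewrite addr_ge0 ?(ltW eps0).
have N0 : 0 < dnorm g by rewrite lt_neqAle eq_sym g0 dnorm_ge0.
set N := dnorm g in g0 N0 *.
pose r := Num.min del rho / 2.
have min0 : 0 < Num.min del rho by rewrite lt_min del0.
have r0 : 0 < r by rewrite divr_gt0.
have rmin : r < Num.min del rho by rewrite /r; lra.
have [rdel rrho] : r < del /\ r < rho by move: rmin; rewrite lt_min => /andP.
pose dM := olc_dscale (r / N) g.
have dMN : dnorm dM = r by rewrite dnormZ ger0_norm ?divr_ge0 ?ltW // divfK.
have gdM : ddot g dM = r * N by rewrite ddotE -dnorm_sqr -/N; field.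
have := Hlip dM; rewrite dMN => /(_ rrho); rewrite ler_norml => /andP[_ H1].
have := H dM; rewrite dMN gdM => /(_ rdel); rewrite ler_norml => /andP[H2 _].
by rewrite -(ler_pM2l r0); lra.
Qed.

Lemma projected_step h m n (kM eta : R) (X g P M : dac R h m n) :
  is_projM kM (dsub X (olc_dscale eta g)) P -> inM kM M ->
  2 * eta * ddot g (dsub X M)
    <= dnorm (dsub X M) ^+ 2 - dnorm (dsub P M) ^+ 2 + eta ^+ 2 * dnorm g ^+ 2.
Proof.
move=> HP HM; have := projM_nonexpansive HP HM.
set Q := dnorm (dsub P M) ^+ 2.
rewrite !dnorm_sqr !ddotE [ddot g X]ddotC [ddot M X]ddotC [ddot M g]ddotC.
lra.
Qed.

(** Nonexpansiveness of the projection towards [X], itself a point of the class. *)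
Lemma projected_step_drift h m n (kM eta : R) (X g P : dac R h m n) :
  0 <= eta -> is_projM kM (dsub X (olc_dscale eta g)) P -> inM kM X ->
  dnorm (dsub P X) <= eta * dnorm g.
Proof.
move=> eta0 HP HX; have := projM_nonexpansive HP HX.
have -> : dnorm (dsub (dsub X (olc_dscale eta g)) X) ^+ 2 = (eta * dnorm g) ^+ 2.
  rewrite exprMn !dnorm_sqr !ddotE [ddot g X]ddotC; ring.
by rewrite ler_sqr ?nnegrE ?mulr_ge0 ?dnorm_ge0.
Qed.

Lemma ogd_regret h m n (kM eta Gb D : R) (T : nat) (Ms gF : nat -> dac R h m n)
    (F : nat -> dac R h m n -> R) (M : dac R h m n) :
  0 < eta -> inM kM M -> dnorm (dsub (Ms 1%N) M) <= D ->
  (forall t, (1 <= t <= T)%N ->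
     [/\ F t (Ms t) - F t M <= ddot (gF t) (dsub (Ms t) M),
         dnorm (gF t) <= Gb &
         is_projM kM (dsub (Ms t) (olc_dscale eta (gF t))) (Ms t.+1)]) ->
  \sum_(1 <= t < T.+1) (F t (Ms t) - F t M)
    <= D ^+ 2 / (2 * eta) + eta * T%:R * Gb ^+ 2 / 2.
Proof.
move=> eta0 HM HD Hstep.
(* Multiplying by [2 * eta] and retaining the last squared distance gives a statement whose
   induction step is exactly [projected_step]: the distances telescope. *)
suff H : 2 * eta * \sum_(1 <= t < T.+1) (F t (Ms t) - F t M)
    + dnorm (dsub (Ms T.+1) M) ^+ 2 <= D ^+ 2 + eta ^+ 2 * T%:R * Gb ^+ 2.
  rewrite -(@ler_pM2l _ (2 * eta)) ?mulr_gt0 //.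
  have -> : 2 * eta * (D ^+ 2 / (2 * eta) + eta * T%:R * Gb ^+ 2 / 2)
    = D ^+ 2 + eta ^+ 2 * T%:R * Gb ^+ 2 by field; rewrite gt_eqF.
  by apply: le_trans H; rewrite lerDl sqr_ge0.
elim: T Hstep => [|T IH] Hstep.
  rewrite big_geq // !mulr0 mul0r add0r addr0.
  by rewrite ler_sqr ?nnegrE ?dnorm_ge0 //; apply: le_trans (dnorm_ge0 _) HD.
have {}IH := IH (fun t tT => Hstep t (let: conj a b := andP tT in
  introT andP (conj a (leqW b)))).
have [H1 H2 H3] := Hstep T.+1 (leqnn _).
have H4 := projected_step H3 HM.
have H5 : dnorm (gF T.+1) ^+ 2 <= Gb ^+ 2.
  by rewrite ler_sqr ?nnegrE ?dnorm_ge0 //; apply: le_trans (dnorm_ge0 _) H2.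
have {}H5 := ler_wpM2l (sqr_ge0 eta) H5.
have H6 : 2 * eta * (F T.+1 (Ms T.+1) - F T.+1 M)
    <= 2 * eta * ddot (gF T.+1) (dsub (Ms T.+1) M).
  by rewrite ler_pM2l // mulr_gt0.
rewrite big_nat_recr //= -natr1.
lra.
Qed.

Lemma iterates_inM h m n (kM eta : R) (T : nat) (Ms gF : nat -> dac R h m n) :
  inM kM (Ms 1%N) ->
  (forall t, (1 <= t <= T)%N ->
     is_projM kM (dsub (Ms t) (olc_dscale eta (gF t))) (Ms t.+1)) ->
  forall t, (0 < t <= T.+1)%N -> inM kM (Ms t).
Proof.
move=> M1 Hp [|[|t]] //= tT; by have [] := Hp t.+1 tT.
Qed.

Lemma iterates_drift h m n (kM eta Gb : R) (T : nat) (Ms gF : nat -> dac R h m n) t k :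
  0 <= eta -> inM kM (Ms 1%N) ->
  (forall t, (1 <= t <= T)%N ->
     is_projM kM (dsub (Ms t) (olc_dscale eta (gF t))) (Ms t.+1)) ->
  (forall t, (1 <= t <= T)%N -> dnorm (gF t) <= Gb) ->
  (k < t)%N -> (t <= T)%N ->
  dnorm (dsub (Ms t) (Ms (t - k)%N)) <= k%:R * (eta * Gb).
Proof.
move=> eta0 M1 Hp Hg; elim: k => [|k IH] kt tT.
  rewrite subn0 mul0r /dnorm big1 ?sqrtr0 // => i _.
  by rewrite /dsub subrr frob0 expr0n.
apply: le_trans (dnormB_triangle _ (Ms (t - k)%N) _) _.
rewrite -natr1 mulrDl mul1r; apply: lerD; first by apply: IH => //; exact: ltnW.
set s := (t - k.+1)%N; have Es : (t - k)%N = s.+1 by rewrite /s subnSK // ltnW.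
have sT : (1 <= s <= T)%N by rewrite subn_gt0 kt leq_subLR (leq_trans tT) ?leq_addl.
rewrite Es; apply: (@le_trans _ _ (eta * dnorm (gF s))).
  apply: (projected_step_drift eta0 (Hp s sT)).
  by apply: (iterates_inM M1 Hp); case/andP: sT => -> /leqW.
by apply: ler_wpM2l => //; exact: Hg.
Qed.

End FirstOrder.

(** * Input-output expansion, surrogate costs and the regret decomposition *)

Section Response.
Context {R : realType} {n m p : nat}.
Context (A : nat -> 'M[R]_n) (B : nat -> 'M[R]_(n, m)) (C : nat -> 'M[R]_(p, n)).
Context (w : nat -> 'cV[R]_n) (e : nat -> 'cV[R]_p).
Set Implicit Arguments. Unset Strict Implicit.

(** Variation of constants: in the induction the lag-1 term is the newest input and disturbance, and
    the other lags are the previous sum multiplied by the newest [A]. *)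
Lemma xstate_unroll (u : nat -> 'cV[R]_m) (t : nat) : (0 < t)%N ->
  xstate A B w u t = \sum_(1 <= k < t)
    Aprod A (t - k) k.-1 *m (B (t - k)%N *m u (t - k)%N + w (t - k)%N).
Proof.
elim: t => // -[_ _|t IH _]; first by rewrite big_geq.
rewrite [LHS]/= -/(xstate A B w u t.+1) IH //.
rewrite [RHS]big_nat_recl //= subSS subn0 mul1mx -addrA addrC; congr (_ + _).
rewrite mulmx_sumr; apply: eq_big_nat => k /andP[k1 kt].
rewrite subSS -[in RHS](prednK k1) /= !mulmxA prednK //.
have -> // : ((t.+1 - k)%N + k)%R = t.+1 by exact: (subnK (ltnW kt)).
Qed.

(** The output under zero input. The signal [olc_sig] recovers it exactly, so the value of [Ffun] at
    a gain does not depend on the past iterates. *)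
Definition natural_response (t : nat) : 'cV[R]_p :=
  \sum_(1 <= k < t) C t *m Aprod A (t - k) k.-1 *m w (t - k)%N + e t.

Lemma yout_natural_response (u : nat -> 'cV[R]_m) (t : nat) : (0 < t)%N ->
  yout A B C w e u t = natural_response t
    + \sum_(1 <= k < t) olc_markov A B C t k *m u (t - k)%N.
Proof.
move=> t0; rewrite /yout /natural_response xstate_unroll // mulmx_sumr.
rewrite addrAC -big_split /=; congr (_ + _); apply: eq_bigr => k _.
by rewrite /olc_markov !mulmxDr !mulmxA addrC.
Qed.

Lemma olc_sig_natural_response h (Ms : nat -> dac R h m n) (t : nat) : (0 < t)%N ->
  olc_sig A B C w e Ms t = natural_response t.
Proof. by move=> t0; rewrite /olc_sig yout_natural_response // addrK. Qed.

(** At lags [k >= t] the truncated subtraction [t - k] is 0, where [v] vanishes; this encodes zero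
    inputs before time 1 and handles memory longer than the elapsed time. *)
Lemma markov_sum_widen (t b : nat) (v : nat -> 'cV[R]_m) : (t <= b)%N -> v 0%N = 0 ->
  \sum_(1 <= k < b) olc_markov A B C t k *m v (t - k)%N
    = \sum_(1 <= k < t) olc_markov A B C t k *m v (t - k)%N.
Proof.
move=> tb v0; case: t tb => [|t] tb.
  by rewrite [RHS]big_geq // big1 // => k _; rewrite sub0n v0 mulmx0.
rewrite (@big_cat_nat _ _ _ t.+1) //= [X in _ + X]big_nat [X in _ + X]big1 ?addr0 //.
by move=> k /andP[tk _]; move: tk; rewrite -subn_eq0 => /eqP ->; rewrite v0 mulmx0.
Qed.

Lemma markov_sum_split (t h : nat) (v : nat -> 'cV[R]_m) : v 0%N = 0 ->
  \sum_(1 <= k < t) olc_markov A B C t k *m v (t - k)%N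
    = \sum_(1 <= k < h.+1) olc_markov A B C t k *m v (t - k)%N
      + \sum_(h.+1 <= k < t) olc_markov A B C t k *m v (t - k)%N.
Proof.
move=> v0; have [th|ht] := leqP t h.+1.
  by rewrite -(markov_sum_widen th v0) [X in _ + X]big_geq // addr0.
by rewrite -big_cat_nat //= ltnW.
Qed.

(** Multiplied by [gam], each power is the difference of two consecutive powers of [1 - gam], so the
    sum telescopes. *)
Lemma geometric_tail_le (gam : R) (a b : nat) : 0 < gam < 1 ->
  \sum_(a.+1 <= k < b) (1 - gam) ^+ k.-1 <= (1 - gam) ^+ a / gam.
Proof.
move=> /andP[g0 g1]; have q0 : 0 <= 1 - gam by rewrite subr_ge0 ltW.
have [ba|/ltnW ab] := leqP b a.+1; first by rewrite big_geq // divr_ge0 ?exprn_ge0 ?(ltW g0).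
rewrite ler_pdivlMr // -(subnKC ab).
suff -> : forall N, (\sum_(a.+1 <= k < a.+1 + N) (1 - gam) ^+ k.-1) * gam
    = (1 - gam) ^+ a - (1 - gam) ^+ (a + N) by rewrite gerBl exprn_ge0.
elim=> [|N IH]; first by rewrite !addn0 big_geq // mul0r subrr.
rewrite addnS big_nat_recr ?leq_addr //= mulrDl IH addnS exprS /=.
ring.
Qed.

Context (ka kb kw ke gam : R).
Context (ka0 : 0 < ka) (kb0 : 0 < kb) (kw0 : 0 < kw) (gam01 : 0 < gam < 1).
Context (HAB : forall t k : nat, (1 <= t)%N ->
     specnorm (C (t + k).+1 *m Aprod A t k *m B t) <= ka * kb * (1 - gam) ^+ k).
Context (HA : forall t k : nat, (1 <= t)%N ->
     specnorm (C (t + k).+1 *m Aprod A t k) <= ka * (1 - gam) ^+ k).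
Context (Hw : forall t : nat, (1 <= t)%N -> frob (w t) <= kw).
Context (He : forall t : nat, (1 <= t)%N -> frob (e t) <= ke).

Let gam0 : 0 < gam. Proof. by case/andP: gam01. Qed.
Let q0 : 0 <= 1 - gam. Proof. by rewrite subr_ge0; case/andP: gam01 => _ /ltW. Qed.

Lemma natural_response_le (t : nat) : (0 < t)%N ->
  frob (natural_response t) <= ka * kw / gam + ke.
Proof.
move=> t0; apply: le_trans (frobD _ _) _; apply: lerD; last exact: He.
apply: le_trans (frob_sum _ _ _) _.
apply: (@le_trans _ _ (\sum_(1 <= k < t) ka * kw * (1 - gam) ^+ k.-1)).
  rewrite !big_nat; apply: ler_sum => k /andP[k1 kt].
  apply: le_trans (frob_mulmx_specnorm _ _) _.
  rewrite mulrAC; apply: ler_pM; rewrite ?frob_ge0 ?Hw ?subn_gt0 //.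
    (* Nonnegativity of the spectral norm, read off at the zero vector. *)
    by apply: le_trans (specnorm_ubound (v := 0) _ _); rewrite ?frob_ge0 ?frob0 ?ler01.
  (* Starting at time [t - k] with [k.-1] factors, the output index of the assumption is [t]. *)
  have := @HA (t - k)%N k.-1; rewrite subn_gt0 kt => /(_ isT).
  by rewrite -addnS prednK // subnK // ltnW.
rewrite -mulr_sumr; apply: ler_wpM2l; first by rewrite mulr_ge0 ?ltW.
by have := @geometric_tail_le gam 0 t gam01; rewrite expr0 mul1r.
Qed.

(** One estimate for several uses: [a = h] gives the truncation tail, while [a = 0] bounds the whole
    response, the effect of drifting gains, or a perturbation of the gain, according to [v]. *)
Lemma markov_tail_le (t a b : nat) (v : nat -> 'cV[R]_m) (V : R) :
  v 0%N = 0 -> 0 <= V -> (forall k, (a < k < t)%N -> (k < b)%N -> frob (v (t - k)%N) <= V) ->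
  frob (\sum_(a.+1 <= k < b) olc_markov A B C t k *m v (t - k)%N)
    <= ka * kb * V * ((1 - gam) ^+ a / gam).
Proof.
move=> v0 V0 Hv; have kab : 0 <= ka * kb by rewrite mulr_ge0 ?ltW.
apply: le_trans (frob_sum _ _ _) _.
apply: (@le_trans _ _ (\sum_(a.+1 <= k < b) ka * kb * V * (1 - gam) ^+ k.-1)).
  rewrite !big_nat; apply: ler_sum => k /andP[ak kb'].
  have [kt|tk] := ltnP k t; last first.
    move: tk; rewrite -subn_eq0 => /eqP ->.
    by rewrite v0 mulmx0 frob0 mulr_ge0 ?exprn_ge0 // mulr_ge0.
  apply: le_trans (frob_mulmx_specnorm _ _) _.
  rewrite mulrAC; apply: ler_pM; rewrite ?frob_ge0 ?Hv ?ak //.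
    by apply: le_trans (specnorm_ubound (v := 0) _ _); rewrite ?frob_ge0 ?frob0 ?ler01.
  have := @HAB (t - k)%N k.-1; rewrite subn_gt0 kt => /(_ isT).
  by rewrite -addnS prednK ?(leq_ltn_trans _ ak) // subnK // ltnW.
rewrite -mulr_sumr; apply: ler_wpM2l; first by rewrite mulr_ge0.
exact: geometric_tail_le.
Qed.

Lemma frob_wz_le (t : nat) : frob (wz w t) <= kw.
Proof. by case: t => [|t] /=; [rewrite frob0 ltW | apply: Hw]. Qed.

Lemma dacu0 h (M : dac R h m n) : dacu w M 0 = 0.
Proof. by rewrite /dacu big1 // => i _; rewrite sub0n mulmx0. Qed.

Lemma dacuD h (M N : dac R h m n) t :
  dacu w (olc_dadd M N) t = dacu w M t + dacu w N t.
Proof. by rewrite -big_split; apply: eq_bigr => i _; rewrite mulmxDl. Qed.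

Lemma dacuZ h (a : R) (M : dac R h m n) t :
  dacu w (olc_dscale a M) t = a *: dacu w M t.
Proof. by rewrite scaler_sumr; apply: eq_bigr => i _; rewrite -scalemxAl. Qed.

Lemma dacuB h (M N : dac R h m n) t :
  dacu w (dsub M N) t = dacu w M t - dacu w N t.
Proof. by rewrite -sumrB; apply: eq_bigr => i _; rewrite mulmxBl. Qed.

Lemma frob_dacu_sum h (M : dac R h m n) t :
  frob (dacu w M t) <= kw * \sum_(k < h) frob (M k).
Proof.
apply: le_trans (frob_sum _ _ _) _; rewrite mulr_sumr; apply: ler_sum => k _.
apply: le_trans (frob_mulmx _ _) _; rewrite mulrC.
by apply: ler_wpM2r; rewrite ?frob_ge0 ?frob_wz_le.
Qed.

Lemma frob_dacu_dnorm h (M : dac R h m n) t :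
  frob (dacu w M t) <= kw * Num.sqrt h%:R * dnorm M.
Proof.
apply: le_trans (frob_dacu_sum _ _) _; rewrite -mulrA.
by apply: ler_wpM2l (sum_frob_le _); exact: ltW.
Qed.

Lemma frob_dacu_inM h (kM : R) (M : dac R h m n) t :
  inM kM M -> frob (dacu w M t) <= kM * kw * h%:R.
Proof.
move=> HM; apply: le_trans (frob_dacu_sum _ _) _.
rewrite (mulrC kM) -mulrA; apply: ler_wpM2l; first exact: ltW.
rewrite mulr_natr -[X in _ *+ X]card_ord -sumr_const.
by apply: ler_sum => k _.
Qed.

Context {h : nat} (kM L : R) (kM0 : 0 < kM) (L0 : 0 <= L).
Context (c : nat -> 'cV[R]_p -> 'cV[R]_m -> R).
Context (Hconv : forall t : nat, (1 <= t)%N -> convex2 (c t)).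
Context (Hlip : forall (t : nat) y u y' u', (1 <= t)%N ->
     `|c t y u - c t y' u'|
       <= L * Num.max (Num.max (znorm y u) (znorm y' u')) 1 * znorm (y - y') (u - u')).

Local Notation Q := (Dtil h ka kb kw ke gam kM).
Local Notation ubound := (kM * kw * h%:R).
Local Notation truncated t b v :=
  (natural_response t + \sum_(1 <= k < b) olc_markov A B C t k *m v (t - k)%N).

Lemma Dtil_ge1 : 1 <= Q.
Proof. by rewrite le_max lexx orbT. Qed.

Let ubound_ge0 : 0 <= ubound.
Proof. by rewrite !mulr_ge0 ?ler0n ?ltW. Qed.

Let ke0 : 0 <= ke.
Proof. by apply: le_trans (He (leqnn 1)); exact: frob_ge0. Qed.

Lemma ubound_le_Dtil : ubound <= Q.
Proof.
rewrite le_max; apply/orP; left; rewrite -!addrA lerDl.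
by rewrite !addr_ge0 ?divr_ge0 ?mulr_ge0 ?ler0n ?(ltW ka0) ?(ltW kb0) ?(ltW kw0)
  ?(ltW kM0) ?(ltW gam0).
Qed.

Lemma truncated_le t b (v : nat -> 'cV[R]_m) : (0 < t)%N -> v 0%N = 0 ->
  (forall k, (0 < k < t)%N -> frob (v (t - k)%N) <= ubound) ->
  frob (truncated t b v) <= Q.
Proof.
move=> t0 v0 Hv; apply: le_trans (frobD _ _) _.
have H1 := natural_response_le t0.
have H2 := @markov_tail_le t 0 b v _ v0 ubound_ge0 (fun k kt _ => Hv k kt).
rewrite expr0 mul1r in H2.
(* Regrouped as input bound, natural response and response to bounded inputs; the last two bound the
   output for every cut-off [b]. *)
have -> : Q = Num.max (ubound + (ka * kw / gam + ke) + ka * kb * ubound / gam) 1.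
  by rewrite /Dtil; congr (Num.max _ 1); ring.
rewrite le_max; apply/orP; left; apply: lerD; last exact: H2.
by apply: le_trans H1 _; rewrite lerDr.
Qed.

Lemma truncatedB t b (v v' : nat -> 'cV[R]_m) :
  truncated t b v - truncated t b v'
    = \sum_(1 <= k < b) olc_markov A B C t k *m (v (t - k)%N - v' (t - k)%N).
Proof.
rewrite opprD addrACA subrr add0r -sumrB.
by apply: eq_bigr => k _; rewrite mulmxBr.
Qed.

(** The factor 2 arises because [znorm] is at most the sum of two norms, each at most [q]; [1 <= q]
    absorbs the maximum with 1. The radius stays a parameter since the gradient bound uses twice
    [Dtil]. *)
Lemma cost_lipschitz t (q : R) y u y' u' : (0 < t)%N -> 1 <= q ->
  frob y <= q -> frob u <= q -> frob y' <= q -> frob u' <= q ->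
  `|c t y u - c t y' u'| <= 2 * L * q * (frob (y - y') + frob (u - u')).
Proof.
move=> t0 q1 Hy Hu Hy' Hu'; apply: le_trans (Hlip _ _ _ _ t0) _.
have zq y1 u1 : frob y1 <= q -> frob u1 <= q -> znorm y1 u1 <= 2 * q.
  by move=> H1 H2; apply: le_trans (znorm_le _ _) _; lra.
apply: ler_pM; rewrite ?znorm_ge0 ?znorm_le //.
  by rewrite mulr_ge0 // le_max ler01 orbT.
have -> : 2 * L * q = L * (2 * q) by ring.
by apply: ler_wpM2l; rewrite // !ge_max !zq //=; lra.
Qed.

Lemma truncation_error t (v : nat -> 'cV[R]_m) u : (0 < t)%N -> v 0%N = 0 ->
  (forall k, (0 < k < t)%N -> frob (v (t - k)%N) <= ubound) -> frob u <= ubound ->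
  `|c t (truncated t t v) u - c t (truncated t h.+1 v) u|
    <= 2 * L * Q * (ka * kb * ubound * ((1 - gam) ^+ h / gam)).
Proof.
move=> t0 v0 Hv Hu; have uQ := le_trans Hu ubound_le_Dtil.
apply: le_trans (cost_lipschitz t0 Dtil_ge1 (truncated_le _ t0 v0 Hv) uQ
  (truncated_le _ t0 v0 Hv) uQ) _.
rewrite subrr frob0 addr0 opprD addrACA subrr add0r (markov_sum_split _ h v0).
rewrite addrAC subrr add0r; apply: ler_wpM2l.
  by rewrite !mulr_ge0 // (le_trans ler01 Dtil_ge1).
by apply: markov_tail_le => // k /andP[hk kt] _; rewrite Hv // kt (leq_ltn_trans _ hk).
Qed.

Lemma Ffun_truncated (Ms : nat -> dac R h m n) t M : (0 < t)%N ->
  Ffun A B C w e c Ms t M = c t (truncated t h.+1 (dacu w M)) (dacu w M t).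
Proof. by move=> t0; rewrite /Ffun olc_sig_natural_response. Qed.

Lemma comparator_error (Ms : nat -> dac R h m n) t M : (0 < t)%N -> inM kM M ->
  `|c t (yout A B C w e (dacu w M) t) (dacu w M t) - Ffun A B C w e c Ms t M|
    <= 2 * L * Q * (ka * kb * ubound * ((1 - gam) ^+ h / gam)).
Proof.
move=> t0 HM; rewrite yout_natural_response // Ffun_truncated //.
by apply: truncation_error; rewrite ?dacu0 // => *; exact: frob_dacu_inM.
Qed.

Lemma policy_drift_error (Ms : nat -> dac R h m n) t (del : R) : (0 < t)%N ->
  (forall s, (0 < s <= t)%N -> inM kM (Ms s)) -> 0 <= del ->
  (forall k, (0 < k < t)%N -> (k <= h)%N -> dnorm (dsub (Ms t) (Ms (t - k)%N)) <= del) ->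
  `|c t (yout A B C w e (ualg w Ms) t) (ualg w Ms t) - Ffun A B C w e c Ms t (Ms t)|
    <= 2 * L * Q * (ka * kb * ubound * ((1 - gam) ^+ h / gam))
       + 2 * L * Q * (ka * kb * (kw * Num.sqrt h%:R * del) / gam).
Proof.
move=> t0 HMs del0 Hdel; rewrite yout_natural_response // Ffun_truncated //.
have a0 : ualg w Ms 0 = 0 by exact: dacu0.
have aM k : (0 < k < t)%N -> frob (ualg w Ms (t - k)%N) <= ubound.
  move=> /andP[k0 kt]; apply: frob_dacu_inM; apply: HMs.
  by rewrite subn_gt0 kt leq_subr.
have dM k : frob (dacu w (Ms t) k) <= ubound.
  by apply: frob_dacu_inM; apply: HMs; rewrite t0 leqnn.
have uQ := le_trans (dM t) ubound_le_Dtil.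
(* The intermediate cost keeps the inputs actually played but truncates the response at lag [h]. *)
apply: le_trans (ler_distD (c t (truncated t h.+1 (ualg w Ms)) (ualg w Ms t)) _ _) _.
apply: lerD; first exact: truncation_error t0 a0 aM (dM t).
apply: le_trans (cost_lipschitz t0 Dtil_ge1 (truncated_le _ t0 a0 aM) uQ
  (truncated_le _ t0 (dacu0 _) (fun k _ => dM _)) uQ) _.
rewrite subrr frob0 addr0 truncatedB; apply: ler_wpM2l.
  by rewrite !mulr_ge0 // (le_trans ler01 Dtil_ge1).
pose v s := ualg w Ms s - dacu w (Ms t) s.
rewrite -[X in _ <= _ * _ / X]invrK -[leRHS]mulr1 -[leRHS]mulrA.
have := @markov_tail_le t 0 h.+1 v (kw * Num.sqrt h%:R * del).
rewrite expr0 mul1r invrK mulr1; apply.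
- by rewrite /v a0 dacu0 subrr.
- by rewrite !mulr_ge0 ?sqrtr_ge0 // ltW.
(* By linearity the difference of inputs is the input of the difference of gains, hence at most
   proportional to the drift. *)
move=> k k0t kh; rewrite /v /ualg -dacuB; apply: le_trans (frob_dacu_dnorm _ _) _.
apply: ler_wpM2l; first by rewrite mulr_ge0 ?sqrtr_ge0 // ltW.
by rewrite dnormB_sym; exact: Hdel.
Qed.

Lemma Ffun_grad_le (Ms : nat -> dac R h m n) t M g : (0 < t)%N -> inM kM M ->
  is_gradD (Ffun A B C w e c Ms t) M g ->
  dnorm g <= 4 * L * Q * ((ka * kb / gam + 1) * (kw * Num.sqrt h%:R)).
Proof.
move=> t0 HM; set lam := (_ + 1) * _.
have lam0 : 0 <= lam.
  by rewrite !mulr_ge0 ?sqrtr_ge0 ?addr_ge0 ?divr_ge0 ?mulr_ge0 ?ler01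
    ?(ltW ka0) ?(ltW kb0) ?(ltW kw0) ?(ltW gam0).
have Q0 : 0 <= Q := le_trans ler01 Dtil_ge1.
(* Within this radius the output and the input each move by at most 1, hence stay below [2 * Q];
   that doubling explains the 4 in the bound. Adding 1 to [lam] keeps the inverse positive. *)
move=> Hg; apply: (is_gradD_norm_le (rho := (lam + 1)^-1) _ _ Hg).
- by apply: mulr_ge0 => //; apply: mulr_ge0 => //; apply: mulr_ge0.
- by rewrite invr_gt0 ltr_wpDl.
move=> dM HdM; rewrite !Ffun_truncated //.
have ldM : lam * dnorm dM <= 1.
  apply: (@le_trans _ _ ((lam + 1) * dnorm dM)).
    by rewrite ler_wpM2r ?dnorm_ge0 // lerDl.
  by rewrite mulrC -ler_pdivlMr ?ltr_wpDl // mul1r ltW.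
pose d s := dacu w dM s.
have dd s : frob (d s) <= kw * Num.sqrt h%:R * dnorm dM by exact: frob_dacu_dnorm.
have Vd0 : 0 <= kw * Num.sqrt h%:R * dnorm dM.
  by rewrite !mulr_ge0 ?sqrtr_ge0 ?dnorm_ge0 // ltW.
have Ed s : dacu w (olc_dadd M dM) s - dacu w M s = d s.
  by rewrite dacuD addrAC subrr add0r.
have yB : truncated t h.+1 (dacu w (olc_dadd M dM)) - truncated t h.+1 (dacu w M)
    = \sum_(1 <= k < h.+1) olc_markov A B C t k *m d (t - k)%N.
  by rewrite truncatedB; apply: eq_bigr => k _; rewrite Ed.
have Hyd := @markov_tail_le t 0 h.+1 d _ (dacu0 _) Vd0 (fun k _ _ => dd _).
rewrite expr0 mul1r -yB in Hyd.
have Hud := dd t; rewrite -Ed in Hud.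
have split_lam : ka * kb * (kw * Num.sqrt h%:R * dnorm dM) / gam
    + kw * Num.sqrt h%:R * dnorm dM = lam * dnorm dM by rewrite /lam; ring.
have kab0 : 0 <= ka * kb * (kw * Num.sqrt h%:R * dnorm dM) / gam.
  apply: divr_ge0; last exact: ltW.
  by apply: mulr_ge0 => //; apply: mulr_ge0; exact: ltW.
have Q1 := Dtil_ge1.
have yQ : frob (truncated t h.+1 (dacu w M)) <= Q.
  by apply: truncated_le; rewrite ?dacu0 // => *; exact: frob_dacu_inM.
have uQ : frob (dacu w M t) <= Q.
  by apply: le_trans ubound_le_Dtil; exact: frob_dacu_inM.
apply: le_trans (@cost_lipschitz t (2 * Q) _ _ _ _ t0 _ _ _ _ _) _; try lra.
- have := frobD (truncated t h.+1 (dacu w (olc_dadd M dM))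
    - truncated t h.+1 (dacu w M)) (truncated t h.+1 (dacu w M)).
  by rewrite subrK => H; lra.
- have := frobD (dacu w (olc_dadd M dM) t - dacu w M t) (dacu w M t).
  by rewrite subrK => H; lra.
rewrite (_ : 4 * L * Q * lam * dnorm dM = 2 * L * (2 * Q) * (lam * dnorm dM)); last by ring.
by apply: ler_wpM2l; rewrite ?mulr_ge0 //; lra.
Qed.

(** The truncated output and the input are affine in the gain, so convexity of the cost passes to
    the surrogate along the segment from [M] to [N]. *)
Lemma Ffun_gradient_gap (Ms : nat -> dac R h m n) t M N g : (0 < t)%N ->
  is_gradD (Ffun A B C w e c Ms t) M g ->
  Ffun A B C w e c Ms t M - Ffun A B C w e c Ms t N <= ddot g (dsub M N).
Proof.
move=> t0 Hg; pose F := Ffun A B C w e c Ms t; rewrite -/(F M) -/(F N).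
pose phi s := F (olc_dadd M (olc_dscale s (dsub N M))).
have phiE s : phi s = c t (truncated t h.+1
      (fun i => s *: dacu w N i + (1 - s) *: dacu w M i))
    (s *: dacu w N t + (1 - s) *: dacu w M t).
  have E i : dacu w (olc_dadd M (olc_dscale s (dsub N M))) i
      = s *: dacu w N i + (1 - s) *: dacu w M i.
    by rewrite dacuD dacuZ dacuB scalerBr scalerBl scale1r addrCA [dacu w M i + _]addrC
      addrA addrC addrA.
  rewrite /phi /F Ffun_truncated // E; congr (c t (_ + _) _).
  by apply: eq_bigr => k _; rewrite E.
have phi0 : phi 0 = F M.
  rewrite phiE /F Ffun_truncated // scale0r add0r subr0 scale1r.
  congr (c t (_ + _) _); apply: eq_bigr => k _.
  by rewrite scale0r add0r scale1r.
suff : ddot g (dsub N M) <= F N - phi 0.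
  by rewrite phi0 !ddotE; lra.
apply: convex_slope_le => [eps eps0|s s01].
  (* Rescaling by this length converts the gradient estimate into one in the parameter [s]; the
     added 1 covers a segment of length zero. *)
  have N0 : 0 < dnorm (dsub N M) + 1 by rewrite ltr_wpDl ?dnorm_ge0.
  have [del del0 H] := Hg _ (divr_gt0 eps0 N0).
  exists (del / (dnorm (dsub N M) + 1)); first exact: divr_gt0.
  move=> s /andP[s0 sd].
  have sN : dnorm (olc_dscale s (dsub N M)) <= s * (dnorm (dsub N M) + 1).
    by rewrite dnormZ gtr0_norm // ler_pM2l // lerDl.
  have := H (olc_dscale s (dsub N M)).
  rewrite ddotZr phi0 => H'; apply: le_trans (H' _) _.
    by apply: le_lt_trans sN _; rewrite -ltr_pdivlMr.
  rewrite -mulrA ler_pM2l // ler_pdivrMl // mulrC; exact: sN.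
rewrite phiE phi0 /F !Ffun_truncated //.
set yN := truncated t _ (dacu w N); set yM := truncated t _ (dacu w M).
have -> : truncated t h.+1 (fun i => s *: dacu w N i + (1 - s) *: dacu w M i)
    = s *: yN + (1 - s) *: yM.
  rewrite /yN /yM; move: (natural_response t) => r.
  rewrite !scalerDr addrACA -scalerDl [s + _]addrC subrK scale1r.
  congr (_ + _); rewrite !scaler_sumr -big_split /=.
  by apply: eq_bigr => k _; rewrite mulmxDr -!scalemxAr.
exact: Hconv.
Qed.

Lemma regret_against_le (T : nat) (eta : R) (Ms gF : nat -> dac R h m n) (M : dac R h m n) :
  let Gb := 4 * L * Q * ((ka * kb / gam + 1) * (kw * Num.sqrt h%:R)) in
  0 < eta -> inM kM (Ms 1%N) ->
  (forall t : nat, (1 <= t <= T)%N ->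
     is_gradD (Ffun A B C w e c Ms t) (Ms t) (gF t)
     /\ is_projM kM (dsub (Ms t) (olc_dscale eta (gF t))) (Ms t.+1)) ->
  inM kM M ->
  \sum_(1 <= t < T.+1) c t (yout A B C w e (ualg w Ms) t) (ualg w Ms t)
  - \sum_(1 <= t < T.+1) c t (yout A B C w e (dacu w M) t) (dacu w M t)
  <= T%:R * (2 * (2 * L * Q * (ka * kb * ubound * ((1 - gam) ^+ h / gam)))
             + 2 * L * Q * (ka * kb * (kw * Num.sqrt h%:R * (h%:R * (eta * Gb))) / gam))
     + (Ddiam h m n kM ^+ 2 / (2 * eta) + eta * T%:R * Gb ^+ 2 / 2).
Proof.
move=> Gb eta0 M1 run HM.
have Hproj := fun t tT => proj2 (run t tT).
have Msin : forall t, (0 < t <= T.+1)%N -> inM kM (Ms t).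
  exact: (iterates_inM M1 Hproj).
have gle t : (1 <= t <= T)%N -> dnorm (gF t) <= Gb.
  move=> tT; have [Hg _] := run t tT; move: tT => /andP[t0 tT].
  by apply: (Ffun_grad_le t0 _ Hg); apply: Msin; rewrite t0 leqW.
have Q0 : 0 <= Q := le_trans ler01 Dtil_ge1.
have Gb0 : 0 <= Gb.
  rewrite /Gb; do 2 apply: mulr_ge0 => //; first by rewrite mulr_ge0.
    by rewrite addr_ge0 ?divr_ge0 ?mulr_ge0 // ltW.
  by rewrite mulr_ge0 ?sqrtr_ge0 // ltW.
have drift t k : (0 < k < t)%N -> (t <= T)%N -> (k <= h)%N ->
    dnorm (dsub (Ms t) (Ms (t - k)%N)) <= h%:R * (eta * Gb).
  move=> /andP[k0 kt] tT kh.
  apply: le_trans (@iterates_drift _ _ _ _ kM eta Gb T Ms gF t k (ltW eta0) M1 Hproj gle kt tT) _.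

  by apply: ler_wpM2r; rewrite ?ler_nat // mulr_ge0 // ltW.
have ogd := ogd_regret (F := Ffun A B C w e c Ms) eta0 HM (Ddiam_ubound M1 HM)
  (fun t tT => let: conj Hg Hp := run t tT in
   And3 (Ffun_gradient_gap M (proj1 (andP tT)) Hg) (gle t tT) Hp).
rewrite -sumrB.
pose F := Ffun A B C w e c Ms.
pose ca t := c t (yout A B C w e (ualg w Ms) t) (ualg w Ms t).
pose cM t := c t (yout A B C w e (dacu w M) t) (dacu w M t).
(* Each round splits into the error of the algorithm against its surrogate, the truncation error of
   the comparator, and the surrogate regret bounded by [ogd]. *)
rewrite (eq_bigr (fun t => (ca t - F t (Ms t) + (F t M - cM t)) + (F t (Ms t) - F t M)));
  last by move=> t _; rewrite /ca /cM; ring.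
rewrite big_split /=; apply: lerD ogd.
set tau := 2 * L * Q * (ka * kb * ubound * ((1 - gam) ^+ h / gam)).
set del := 2 * L * Q * (_ / gam).
(* One [tau] comes from the algorithm and one from the comparator; only the algorithm drifts. *)
apply: (@le_trans _ _ (\sum_(1 <= t < T.+1) (2 * tau + del))); last first.
  by rewrite sumr_const_nat subSS subn0 [leRHS]mulr_natl.
rewrite !big_nat; apply: ler_sum => t /andP[t0 tT].
have Hc := comparator_error Ms t0 HM.
have Hp : `|ca t - F t (Ms t)| <= tau + del.
  apply: policy_drift_error => //.
  - by move=> s /andP[s0 st]; apply: Msin; rewrite s0 (leq_trans st) // ltnW.
  - by apply: mulr_ge0 => //; apply: mulr_ge0 => //; exact: ltW.
  - by move=> k kt; apply: drift.
move: Hc Hp; rewrite !ler_norml -/(cM t) -/(F t M) -/tau => /andP[H1 _] /andP[_ H2].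
lra.
Qed.

End Response.

(** * Memory length, step size and the resulting rate *)

Section Rate.
Context {R : realType}.
Set Implicit Arguments. Unset Strict Implicit.

Lemma hmem_ge (T : nat) (gam : R) : (1 < T)%N -> 0 < gam < 1 ->
  (0 < hmem T gam)%N /\ T%:R * (1 - gam) ^+ hmem T gam <= 1.
Proof.
move=> T1 /andP[g0 g1].
have q0 : 0 < 1 - gam by rewrite subr_gt0.
have T0 : 0 < T%:R :> R by rewrite ltr0n ltnW.
have lnq : 0 < ln (1 - gam)^-1.
  by rewrite ln_gt0 // invf_gt1 // ltrBlDr ltrDl.
have lnT : 0 < ln (T%:R : R) by rewrite ln_gt0 // ltr1n.
have r0 : 0 < ln (T%:R : R) / ln (1 - gam)^-1 by exact: divr_gt0.
(* A positive ceiling is its own absolute value, so [hmem] really is the ceiling. *)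
have c0 : 0 < Num.ceil (ln (T%:R : R) / ln (1 - gam)^-1) by rewrite ceil_gt0.
have Hh : ln (T%:R : R) / ln (1 - gam)^-1 <= (hmem T gam)%:R.
  by apply: le_trans (ceil_ge _) _; rewrite /hmem natr_absz gtr0_norm.
split; first by rewrite -(@ltr0n R); exact: lt_le_trans Hh.
have Hp : T%:R <= ((1 - gam)^-1) ^+ hmem T gam.
  rewrite -ler_ln ?posrE ?exprn_gt0 ?invr_gt0 // lnXn ?invr_gt0 //.
  by rewrite -[leRHS]mulr_natl -ler_pdivrMr.
by rewrite -ler_pdivlMr ?exprn_gt0 // mul1r -exprVn.
Qed.

(** In the constant, [1 / 2] comes from the initial distance, [8 * (L / G) ^+ 2] from the squared
    gradients, [4 * (L / G)] from the two truncation errors and [8 * (L / G) / gam] from the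
    drift. *)
Lemma regret_rate (ka kb kw ke gam kM L G D : R) (h m n T : nat) :
  0 < ka -> 0 < kb -> 0 < kw -> 0 < gam < 1 -> 0 < kM -> 0 < L -> 0 < G ->
  (0 < h)%N -> (0 < m)%N -> (0 < n)%N -> (0 < T)%N -> kM <= D ->
  T%:R * (1 - gam) ^+ h <= 1 ->
  let Q := Dtil h ka kb kw ke gam kM in
  let Gb := 4 * L * Q * ((ka * kb / gam + 1) * (kw * Num.sqrt h%:R)) in
  let S := Num.sqrt (Gf h n m ka kb kw ke gam kM G
    * (Gf h n m ka kb kw ke gam kM G + Lf h ka kb kw ke gam kM L * h%:R ^+ 2) * T%:R) in
  let eta := D / S in
  0 < S /\
  T%:R * (2 * (2 * L * Q * (ka * kb * (kM * kw * h%:R) * ((1 - gam) ^+ h / gam)))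
          + 2 * L * Q * (ka * kb * (kw * Num.sqrt h%:R * (h%:R * (eta * Gb))) / gam))
     + (D ^+ 2 / (2 * eta) + eta * T%:R * Gb ^+ 2 / 2)
  <= (1 / 2 + 8 * (L / G) ^+ 2 + 4 * (L / G) + 8 * (L / G) / gam) * (D * S).
Proof.
move=> ka0 kb0 kw0 /andP[g0 g1] kM0 L0 G0 h0 m0 n0 T0 kD.
rewrite /Gf /Lf; set Q := Dtil _ _ _ _ _ _ _.
have Q0 : 0 < Q by rewrite lt_max ltr01 orbT.
move: Q Q0 => Q Q0.
have H1 : 1 <= h%:R :> R by rewrite ler1n.
have N1 : 1 <= n%:R * m%:R :> R by rewrite -natrM ler1n muln_gt0 n0.
have T1 : 1 <= T%:R :> R by rewrite ler1n.
set sh := Num.sqrt h%:R.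
have sh0 : 0 < sh by rewrite sqrtr_gt0 ltr0n.
have shh : sh <= h%:R.
  rewrite -[leRHS]ger0_norm ?ler0n // -sqrtr_sqr ler_wsqrtr //.
  by rewrite expr2 ler_peMl.
set q := (1 - gam) ^+ h; have q0 : 0 <= q by rewrite exprn_ge0 // subr_ge0 ltW.
move: (h%:R : R) (T%:R : R) (sh) (q) H1 T1 sh0 shh q0 => {h h0 T T0 sh q}.
move=> h T sh q h1 T1 sh0 shh q0 Tq /=.
set g := ka * kb * kw / gam + kw.
have kabw : 0 < ka * kb * kw by rewrite !mulr_gt0.
have kg : 0 < ka * kb * kw / gam by rewrite divr_gt0.
have gp : 0 < g by rewrite addr_gt0.
set Gf := G * Q * h * n%:R * m%:R * g.
set Lf := L * Q * _.
set S := Num.sqrt _.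
set Gb := 4 * L * Q * _.
have rho0 : 0 < L / G by rewrite divr_gt0.
(* Writing [L] as [rho * G] converts bounds carrying [L] into multiples of [Gf]. *)
have EL : L = L / G * G by rewrite divfK // gt_eqF.
move: (L / G) rho0 EL => rho rho0 EL.
have hp : 0 < h by apply: lt_le_trans h1.
have Tp : 0 < T by apply: lt_le_trans T1.
have Dp : 0 < D by apply: lt_le_trans kD.
have GfE : Gf = (G * Q * h * g) * (n%:R * m%:R) by rewrite /Gf; ring.
have Gfge : G * Q * h * g <= Gf by rewrite GfE ler_peMr // !mulr_ge0 // ltW.
have Gf0 : 0 < Gf by apply: lt_le_trans Gfge; rewrite !mulr_gt0.
have Lfge : L * Q * (ka * kb * kw * sh) <= Lf.
  by rewrite /Lf ler_wpM2l ?mulr_ge0 ?(ltW L0) ?(ltW Q0) // lerDl mulr_ge0 ?(ltW kw0) ?(ltW sh0).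
have Lf0 : 0 < Lf by apply: lt_le_trans Lfge; rewrite !mulr_gt0.
have Lfh : 0 < Lf * h ^+ 2 by rewrite mulr_gt0 // exprn_gt0.
have radicand : 0 < Gf * (Gf + Lf * h ^+ 2) * T.
  by apply: mulr_gt0 => //; apply: mulr_gt0 => //; exact: addr_gt0.
have S2 : S ^+ 2 = Gf * (Gf + Lf * h ^+ 2) * T by rewrite sqr_sqrtr // ltW.
have S0 : 0 < S by rewrite sqrtr_gt0.
split=> //.
have GfS : Gf <= S.
  rewrite -ler_sqr ?nnegrE ?(ltW Gf0) ?(ltW S0) // S2 mulrDr mulrDl -expr2.
  rewrite -[leLHS]addr0; apply: lerD.
    by rewrite ler_peMr // sqr_ge0.
  by apply: ltW; apply: mulr_gt0 => //; exact: mulr_gt0.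
have Gb0 : 0 <= Gb by rewrite !mulr_ge0 ?addr_ge0 ?divr_ge0 ?mulr_ge0 // ltW.
have GbGf : Gb <= 4 * rho * Gf.
  apply: (@le_trans _ _ (4 * rho * (G * Q * h * g))); last first.
    by rewrite ler_pM2l // mulr_gt0.
  rewrite (_ : Gb = 4 * rho * (G * Q * sh * g)); last by rewrite /Gb EL /g; ring.
  rewrite ler_pM2l; last by rewrite mulr_gt0.
  by rewrite ler_pM2r // ler_pM2l // mulr_gt0.
set eta := D / S.
have eta0 : 0 < eta by rewrite divr_gt0.
(* The terms linear in [eta] are compared with the target through this identity: it suffices to
   bound their cofactor by a multiple of the radicand. *)
have etaS : eta * S ^+ 2 = D * S by rewrite /eta expr2 mulrA divfK // gt_eqF.
(* The choice of memory gives [T * q <= 1], which removes the factor [T]; what remains is at most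
   [kM * Gf], and [kM <= D], [Gf <= S]. *)
have B1 : T * (2 * L * Q * (ka * kb * (kM * kw * h) * (q / gam))) <= 2 * rho * (D * S).
  rewrite (_ : T * _ = 2 * rho * (kM * (G * Q * h * (ka * kb * kw / gam)) * (T * q)));
    last by rewrite EL; ring.
  rewrite ler_pM2l; last by rewrite mulr_gt0.
  apply: (@le_trans _ _ (kM * (G * Q * h * (ka * kb * kw / gam)))).
    by rewrite ler_piMr // !mulr_ge0 ?invr_ge0 // ltW.
  apply: ler_pM => //; [exact: ltW|by rewrite !mulr_ge0 ?invr_ge0 // ltW|].
  apply: le_trans GfS; apply: le_trans Gfge; rewrite ler_pM2l; last by rewrite !mulr_gt0.
  by rewrite lerDl ltW.
(* The drift is paid for by the cross term [Gf * (Lf * h ^+ 2)] of the radicand. *)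
have B2 : T * (2 * L * Q * (ka * kb * (kw * sh * (h * (eta * Gb))) / gam))
    <= 8 * rho / gam * (D * S).
  rewrite (_ : T * _ = 2 / gam * ((L * Q * (ka * kb * kw * sh)) * h * (eta * Gb) * T));
    last by ring.
  rewrite (_ : 8 * rho / gam * (D * S) = 2 / gam * (4 * rho * (D * S))); last by ring.
  rewrite ler_pM2l ?divr_gt0 //.
  apply: (@le_trans _ _ (Lf * h ^+ 2 * (eta * (4 * rho * Gf)) * T)).
    apply: ler_wpM2r; first exact: ltW.
    have X0 : 0 < L * Q * (ka * kb * kw * sh).
      by apply: mulr_gt0; apply: mulr_gt0.
    apply: ler_pM; [by rewrite ltW // mulr_gt0|by rewrite mulr_ge0 // ltW| |].
      apply: ler_pM; [exact: ltW|exact: ltW|by []|].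
      by rewrite expr2 ler_peMl // ltW.
    by rewrite ler_pM2l.
  rewrite -etaS S2.
  rewrite (_ : Lf * _ * _ * T = 4 * rho * (eta * (Gf * (Lf * h ^+ 2) * T))); last by ring.
  rewrite ler_pM2l ?mulr_gt0 // ler_pM2l // ler_pM2r // ler_pM2l //.
  by rewrite lerDr ltW.
have B3 : D ^+ 2 / (2 * eta) = 1 / 2 * (D * S).
  by rewrite /eta; field; rewrite !gt_eqF.
(* The squared gradients are paid for by the [Gf * Gf] part of the radicand. *)
have B4 : eta * T * Gb ^+ 2 / 2 <= 8 * rho ^+ 2 * (D * S).
  apply: (@le_trans _ _ (eta * T * (4 * rho * Gf) ^+ 2 / 2)).
    rewrite ler_pM2r // ler_pM2l ?(mulr_gt0 eta0 Tp) //.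
    by rewrite ler_sqr ?nnegrE // (le_trans Gb0).
  rewrite -etaS S2.
  rewrite (_ : _ / 2 = 8 * rho ^+ 2 * (eta * (Gf * Gf * T))); last by field.
  rewrite ler_pM2l ?mulr_gt0 ?exprn_gt0 // ler_pM2l // ler_pM2r // ler_pM2l //.
  by rewrite lerDl mulr_ge0 ?sqr_ge0 // ltW.
rewrite B3; lra.
Qed.

End Rate.

(** * Degenerate cases and passage to the infimum over comparators *)

Section Degenerate.
Context {R : realType}.
Set Implicit Arguments. Unset Strict Implicit.

(** A critical point of a convex function is a global minimiser; here every point is critical, so
    any two values bound each other. *)
Lemma convex2_zero_grad_const p m (f : 'cV[R]_p -> 'cV[R]_m -> R) gy gu :
  convex2 f -> is_grad f gy gu -> (forall y u, gy y u = 0 /\ gu y u = 0) ->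
  forall y u y' u', f y u = f y' u'.
Proof.
move=> Hc Hg H0; suff le y u y' u' : f y u <= f y' u' by move=> *; apply/eqP; rewrite eq_le !le.
pose phi s := f (s *: y' + (1 - s) *: y) (s *: u' + (1 - s) *: u).
have phi0 : phi 0 = f y u by rewrite /phi !scale0r !add0r subr0 !scale1r.
rewrite -subr_ge0 -phi0; apply: convex_slope_le => [eps eps0|s s01]; last first.
  by rewrite phi0; exact: Hc.
set N := znorm (y' - y) (u' - u) + 1.
have N0 : 0 < N by rewrite ltr_wpDl ?znorm_ge0.
have [del del0 H] := Hg y u _ (divr_gt0 eps0 N0).
exists (del / N) => [|s /andP[s0 sd]]; first exact: divr_gt0.
have segment k (z z' : 'cV[R]_k) : s *: z' + (1 - s) *: z = z + s *: (z' - z).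
  by rewrite scalerBr scalerBl scale1r addrCA.
have zs : znorm (s *: (y' - y)) (s *: (u' - u)) <= s * N.
  rewrite /znorm !frobZ !exprMn -mulrDr sqrtrM ?sqr_ge0 // sqrtr_sqr normr_id.
  by rewrite gtr0_norm // ler_pM2l // lerDl.
rewrite mulr0 subr0 phi0 /phi !segment.
have := H (s *: (y' - y)) (s *: (u' - u)); have [-> ->] := H0 y u.
have fdot0 k (z : 'cV[R]_k) : fdot 0 z = 0.
  by rewrite fdotE big1 // => i _; rewrite mxE mul0r.
rewrite !fdot0 addr0 subr0 => H'; apply: le_trans (H' _) _.
  by apply: le_lt_trans zs _; rewrite -ltr_pdivlMr.
rewrite -mulrA ler_pM2l // ler_pdivrMl // mulrC; exact: zs.
Qed.

Lemma dacu_trivial n m h (w : nat -> 'cV[R]_n) (M : dac R h m n) t :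
  (m == 0)%N || (n == 0)%N -> dacu w M t = 0.
Proof.
case/orP => /eqP E; rewrite /dacu.
  by subst m; rewrite big1 // => i _; exact: flatmx0.
by subst n; rewrite big1 // => i _; rewrite [M i]thinmx0 mul0mx.
Qed.

(** A common lower bound passes to the infimum because the class contains the zero gain; no
    minimiser has to be produced. *)
Lemma regret_le h n m p A B C w e c (kM b : R) (Ms : nat -> dac R h m n) T :
  0 <= kM ->
  (forall M : dac R h m n, inM kM M ->
    \sum_(1 <= t < T.+1) c t (@yout R n m p A B C w e (ualg w Ms) t) (ualg w Ms t)
    - \sum_(1 <= t < T.+1) c t (yout A B C w e (dacu w M) t) (dacu w M t) <= b) ->
  regret A B C w e c kM Ms T <= b.
Proof.
move=> kM0 H; rewrite /regret lerBlDr -lerBlDl; apply: lb_le_inf.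
  by eexists; exists (fun=> 0) => // k; rewrite frob0.
by move=> _ [M HM <-]; rewrite lerBlDl -lerBlDr; exact: H.
Qed.

End Degenerate.

Theorem theorem1 (R : realType) (n m p : nat) (ka kb kw ke gam L G kM : R) :
  0 < ka -> 0 < kb -> 0 < kw -> 0 < ke -> 0 < gam < 1 -> 0 < kM ->
  exists Cst : R, forall T : nat, (3 <= T)%N ->
  let h := hmem T gam in
  let D := Ddiam h m n kM in
  let Lf_ := Lf h ka kb kw ke gam kM L in
  let Gf_ := Gf h n m ka kb kw ke gam kM G in
  let eta := D / Num.sqrt (Gf_ * (Gf_ + Lf_ * h%:R ^+ 2) * T%:R) in
  forall (A : nat -> 'M[R]_n) (B : nat -> 'M[R]_(n, m)) (C : nat -> 'M[R]_(p, n))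
         (w : nat -> 'cV[R]_n) (e : nat -> 'cV[R]_p)
         (c : nat -> 'cV[R]_p -> 'cV[R]_m -> R)
         (gy : nat -> 'cV[R]_p -> 'cV[R]_m -> 'cV[R]_p)
         (gu : nat -> 'cV[R]_p -> 'cV[R]_m -> 'cV[R]_m),
  (* standing assumptions on the system (time indices t >= 1) *)
  (forall t k : nat, (1 <= t)%N ->
     specnorm (C (t + k).+1 *m Aprod A t k *m B t) <= ka * kb * (1 - gam) ^+ k) ->
  (forall t k : nat, (1 <= t)%N ->
     specnorm (C (t + k).+1 *m Aprod A t k) <= ka * (1 - gam) ^+ k) ->
  (forall t : nat, (1 <= t)%N -> specnorm (B t) <= kb) ->
  (forall t : nat, (1 <= t)%N -> frob (w t) <= kw) ->
  (forall t : nat, (1 <= t)%N -> frob (e t) <= ke) ->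
  (* standing assumptions on the costs *)
  (forall t : nat, (1 <= t)%N -> convex2 (c t)) ->
  (forall t : nat, (1 <= t)%N -> is_grad (c t) (gy t) (gu t)) ->
  (forall (t : nat) y u y' u', (1 <= t)%N ->
     `|c t y u - c t y' u'|
       <= L * Num.max (Num.max (znorm y u) (znorm y' u')) 1 * znorm (y - y') (u - u')) ->
  (forall (t : nat) (d : R) y u, (1 <= t)%N -> 0 < d -> frob y <= d -> frob u <= d ->
     frob (gy t y u) <= G * d /\ frob (gu t y u) <= G * d) ->
  (* any run of OLC-FK: iterates Ms, gradients gF of F_t at Ms t, projected steps *)
  forall (Ms gF : nat -> dac R h m n),
  inM kM (Ms 1%N) ->
  (forall t : nat, (1 <= t <= T)%N ->
     is_gradD (Ffun A B C w e c Ms t) (Ms t) (gF t)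
     /\ is_projM kM (dsub (Ms t) (olc_dscale eta (gF t))) (Ms t.+1)) ->
  regret A B C w e c kM Ms T
    <= Cst * (D * Num.sqrt (Gf_ * (Gf_ + Lf_ * h%:R ^+ 2)) * Num.sqrt T%:R).
Proof.
move=> ka0 kb0 kw0 ke0 gam01 kM0.
(* When a dimension is zero, [Gf] and the target bound vanish, so the regret itself must be
   nonpositive. *)
have [triv|] := boolP ((m == 0)%N || (n == 0)%N).
  exists 0 => T T3 h D Lf_ Gf_ eta A B C w e c gy gu _ _ _ _ _ _ _ _ _ Ms gF _ _.
  rewrite mul0r; apply: regret_le => [|M _]; first exact: ltW.
  have -> : ualg w Ms = fun=> 0 by apply/funext => t; exact: dacu_trivial.
  have -> : dacu w M = fun=> 0 by apply/funext => t; exact: dacu_trivial.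
  by rewrite subrr.
rewrite negb_or -!lt0n => /andP[m0 n0].
have [GL|] := boolP ((G <= 0) || (L <= 0)).
  exists 0 => T T3 h D Lf_ Gf_ eta A B C w e c gy gu _ _ _ _ _ Hc Hg HL HG Ms gF _ _.
  have c_const t y u y' u' : (0 < t)%N -> c t y u = c t y' u'.
    move=> t0; case/orP: GL => [G0|L0].
      apply: (convex2_zero_grad_const (Hc t t0) (Hg t t0)) => {}y {}u.
      (* Any [d] above both norms works: with [G <= 0] the gradient bound [G * d] is nonpositive,
         which forces both gradients to vanish. *)
      set d := frob y + frob u + 1.
      have d0 : 0 < d by rewrite ltr_wpDl // addr_ge0 ?frob_ge0.
      have yd : frob y <= d by rewrite /d -addrA lerDl addr_ge0 ?frob_ge0.
      have ud : frob u <= d.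
        by rewrite /d [frob y + _]addrC -addrA lerDl addr_ge0 ?frob_ge0.
      have [H1 H2] := HG t d y u t0 d0 yd ud.
      have Gd : G * d <= 0 by rewrite mulr_le0_ge0 // ltW.
      split; apply: frob_eq0; apply/eqP; rewrite eq_le frob_ge0 andbT.
        exact: le_trans H1 Gd.
      exact: le_trans H2 Gd.
    apply/eqP; rewrite -subr_eq0 -normr_le0; apply: le_trans (HL _ _ _ _ _ t0) _.
    rewrite mulr_le0_ge0 ?znorm_ge0 // mulr_le0_ge0 //.
    by rewrite le_max ler01 orbT.
  rewrite mul0r; apply: regret_le => [|M _]; first exact: ltW.
  rewrite -sumrB big_nat big1 // => t /andP[t0 _].
  by apply/eqP; rewrite subr_eq0; apply/eqP; exact: c_const.
rewrite negb_or -!ltNge => /andP[G0 L0].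
exists (1 / 2 + 8 * (L / G) ^+ 2 + 4 * (L / G) + 8 * (L / G) / gam).
move=> T T3 h D Lf_ Gf_ eta A B C w e c gy gu HAB HA _ Hw He Hc _ HL _ Ms gF M1 run.
have T0 : (0 < T)%N by apply: leq_trans T3.
have [h0 hT] := hmem_ge (leq_trans (isT : (1 < 3)%N) T3) gam01.
have kD : kM <= D := Ddiam_ge kM0 h0 m0 n0.
have [S0 rate] := regret_rate ke ka0 kb0 kw0 gam01 kM0 L0 G0 h0 m0 n0 T0 kD hT.
have eta0 : 0 < eta by rewrite divr_gt0 // (lt_le_trans kM0 kD).
(* Splitting the root requires a nonnegative first factor, which is extracted from the positivity of
   the full radicand. *)
have -> : D * Num.sqrt (Gf_ * (Gf_ + Lf_ * h%:R ^+ 2)) * Num.sqrt T%:R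
    = D * Num.sqrt (Gf_ * (Gf_ + Lf_ * h%:R ^+ 2) * T%:R).
  rewrite -mulrA; congr (_ * _); rewrite [RHS]sqrtrM //; apply: ltW; move: S0.
  by rewrite sqrtr_gt0 pmulr_lgt0 // ltr0n.
apply: regret_le => [|M HM]; first exact: ltW.
apply: le_trans rate.
exact: (regret_against_le ka0 kb0 kw0 gam01 HAB HA Hw He kM0 (ltW L0) Hc HL eta0 M1 run HM).
Qed.
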